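(* Let $G,\Sigma\in\mathbb{R}^{d\times d}$ and $g\in\mathbb{R}^d$, where $\Sigma$ is symmetric positive definite, and suppose the spectral radius of $G$ is less than $1$. Define $$\mathcal{A} = \Big(\sum_{l=0}^\infty G^l\,\Sigma\,(G^T)^l\Big)^{-1},\qquad M=\mathcal{A}(I-G)^{-1},\qquad N=\mathcal{A}(I-G)^{-1}G,\qquad \beta=\mathcal{A}(I-G)^{-1}g .$$ Then the AR(1) process $y=Gx+g+\nu$, with $\nu\sim N(0,\Sigma)$, can be written in the matrix splitting form $My=Nx+\beta+\nu'$ with $\nu'\sim N(0,M^T+N)$; that is, $G=M^{-1}N$, $g=M^{-1}\beta$ and $\Sigma=M^{-1}(M^T+N)M^{-T}$. Moreover $\mathcal{A}=M-N$ is symmetric and positive definite.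
   Context: $N(m,C)$ denotes the normal distribution with mean $m$ and covariance $C$, and $M^{-T}=(M^{-1})^T$. An AR(1) process generates $y\in\mathbb{R}^d$ from $x\in\mathbb{R}^d$ by $y=Gx+g+\nu$ with $\nu\sim N(0,\Sigma)$ drawn independently at each step. *)

(* Defs.v *)
From HB Require Import structures.
From mathcomp Require Import all_boot all_order all_algebra.
From mathcomp Require Import all_classical all_reals all_analysis.
From mathcomp Require Import complex.

Set Implicit Arguments.
Unset Strict Implicit.
Unset Printing Implicit Defensive.

Import Order.TTheory GRing.Theory Num.Theory.
Import numFieldNormedType.Exports.

Local Open Scope classical_set_scope.
Local Open Scope ring_scope.

(* The spectrum is taken over R[i], since a real matrix need not have real
   eigenvalues. It is a finite set, nonempty for 0 < d; for d = 0 the supremum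
   of the empty set is 0. *)
Definition spectral_radius (R : realType) (d : nat) (G : 'M[R]_d) : R :=
  sup [set r : R | exists z : R[i],
         eigenvalue (map_mx (real_complex R) G) z
         /\ r = ComplexField.Normc.normc z].

Definition posdefmx (R : realType) (d : nat) (C : 'M[R]_d) : Prop :=
  forall u : 'cV[R]_d, u != 0 -> 0 < (u^T *m C *m u) 0 0.

Definition possemidefmx (R : realType) (d : nat) (C : 'M[R]_d) : Prop :=
  forall u : 'cV[R]_d, 0 <= (u^T *m C *m u) 0 0.

Definition borel (R : realType) (d : nat) : set (set 'cV[R]_d) :=
  <<s @open 'cV[R]_d >>.

Definition random_vector (R : realType) (d : nat) (disp : measure_display)
    (T : measurableType disp) (X : T -> 'cV[R]_d) : Prop :=
  forall B : set 'cV[R]_d, borel B -> measurable (X @^-1` B).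

(* The normal law on R with mean m and variance v. [normal_prob] is
   parameterized by the standard deviation and is not a Dirac mass when the
   latter is 0, so the degenerate case is treated separately. *)
Definition normal_law (R : realType) (m v : R) (B : set R) : \bar R :=
  if v == 0 then \d_m B else normal_prob m (Num.sqrt v) B.

(* X ~ N(m, C) under P: every linear functional u^T X of the random vector X is
   normal, with mean u^T m and variance u^T C u. *)
Definition normal_vector (R : realType) (d : nat) (disp : measure_display)
    (T : measurableType disp) (P : probability T R)
    (X : T -> 'cV[R]_d) (m : 'cV[R]_d) (C : 'M[R]_d) : Prop :=
  [/\ random_vector X, C^T = C, possemidefmx C &
      forall (u : 'cV[R]_d) (B : set R), measurable B ->
        P [set w | B ((u^T *m X w) 0 0)]
        = normal_law ((u^T *m m) 0 0) ((u^T *m C *m u) 0 0) B].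

Definition independent_vectors (R : realType) (d : nat)
    (disp : measure_display) (T : measurableType disp) (P : probability T R)
    (X : nat -> T -> 'cV[R]_d) : Prop :=
  (forall k, random_vector (X k)) /\
  forall (s : seq nat) (B : nat -> set 'cV[R]_d),
    uniq s -> (forall k, borel (B k)) ->
    P (\bigcap_(k in [set` s]) (X k @^-1` B k))
    = (\prod_(k <- s) P (X k @^-1` B k))%E.

(* nu k is the noise drawn at the step from Y k to Y k.+1: the family
   Y 0, nu 0, nu 1, ... is mutually independent, so that in each step the new
   noise is independent of the past. *)
Definition normal_noise (R : realType) (d : nat) (disp : measure_display)
    (T : measurableType disp) (P : probability T R) (C : 'M[R]_d)
    (Y nu : nat -> T -> 'cV[R]_d) : Prop :=
  (forall k, normal_vector P (nu k) 0 C) /\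
  independent_vectors P (fun k => if k is j.+1 then nu j else Y 0%N).

Definition ar1_process (R : realType) (d : nat) (disp : measure_display)
    (T : measurableType disp) (P : probability T R)
    (G : 'M[R]_d) (g : 'cV[R]_d) (Sigma : 'M[R]_d)
    (Y : nat -> T -> 'cV[R]_d) : Prop :=
  exists nu : nat -> T -> 'cV[R]_d, normal_noise P Sigma Y nu /\
    forall k w, Y k.+1 w = G *m Y k w + g + nu k w.

Definition splitting_process (R : realType) (d : nat) (disp : measure_display)
    (T : measurableType disp) (P : probability T R)
    (M N : 'M[R]_d) (beta : 'cV[R]_d) (C : 'M[R]_d)
    (Y : nat -> T -> 'cV[R]_d) : Prop :=
  exists nu' : nat -> T -> 'cV[R]_d, normal_noise P C Y nu' /\
    forall k w, M *m Y k.+1 w = N *m Y k w + beta + nu' k w.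

(* Main.v *)
Require Import Defs.
From HB Require Import structures.
From mathcomp Require Import all_boot all_order all_algebra.
From mathcomp Require Import all_classical all_reals all_analysis.
From mathcomp Require Import complex ring lra.

Set Implicit Arguments.
Unset Strict Implicit.
Unset Printing Implicit Defensive.

Import Order.TTheory GRing.Theory Num.Theory.
Import numFieldNormedType.Exports.

Local Open Scope classical_set_scope.
Local Open Scope ring_scope.

(** The idea. Let S be the sum of the series, the stationary covariance of the
    process. It solves the Stein equation S = Sigma + G S G^T
    ([stein_equation]), which is obtained by conjugating the series by G. As
    A = S^-1, the matrix M = A (1 - G)^-1 has inverse (1 - G) S, and by
    construction N = M G and beta = M g. Hence M - N = A, and expanding
    M^-1 (M^T + N) M^-T gives S - G S G^T = Sigma ([splitting_covariance]);
    equivalently M^T + N = M Sigma M^T. The splitting form is therefore the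
    AR(1) recurrence multiplied by M, with noise M nu: a linear map sends an
    independent Gaussian noise of covariance Sigma to one of covariance
    M Sigma M^T, and the inverse map brings it back ([normal_noise_mulmx],
    [ar1_splitting]).

    The analytic content is that the series converges. For this one needs the
    entries of G^l to be O(r^l) for some r < 1 ([powers_bound]). The complex
    matrix G is annihilated by the product of the factors G - z over its
    eigenvalues z (Cayley-Hamilton), and removing these factors one at a time
    turns the bound into a scalar recurrence u_(l+1) = z u_l + O(r^l) with
    |z| < r ([annihilated_powers_bound]).

    Positive definiteness of S follows from that of Sigma, because the Stein
    equation writes S as Sigma plus a positive semidefinite matrix; the inverse
    A inherits symmetry and positive definiteness. The matrix 1 - G is
    invertible because 1 is not an eigenvalue of G. *)

Local Notation normc := ComplexField.Normc.normc.

(** * Powers of a matrix of spectral radius below one *)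

Lemma normc_ge0 (R : rcfType) (z : R[i]) : 0 <= normc z.
Proof. by case: z => a b; apply: sqrtr_ge0. Qed.

Lemma normc_real (R : rcfType) (x : R) : normc (real_complex R x) = `|x|.
Proof. by rewrite /= expr0n addr0 sqrtr_sqr. Qed.

(** The constant D = B + K / (r - |z|) survives a step of the recurrence because
    |z| D + K <= r D: the gap r - |z| leaves room for the driving term. *)
Lemma perturbed_geometric_bound (R : rcfType) (z : R[i]) (u w : nat -> R[i])
    (r B K : R) :
  normc z < r ->
  normc (u 0%N) <= B ->
  (forall l, normc (w l) <= K * r ^+ l) ->
  (forall l, u l.+1 = z * u l + w l) ->
  forall l, normc (u l) <= (B + K / (r - normc z)) * r ^+ l.
Proof.
move=> zr u0 wK uS.
have r0 : 0 < r by apply: le_lt_trans zr; exact: normc_ge0.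
have B0 : 0 <= B by apply: le_trans u0; exact: normc_ge0.
have gap0 : 0 < r - normc z by rewrite subr_gt0.
have K0 : 0 <= K.
  by have := wK 0%N; rewrite expr0 mulr1; apply: le_trans; exact: normc_ge0.
elim=> [|l IHl].
  by rewrite expr0 mulr1 (le_trans u0)// lerDl divr_ge0// ltW.
rewrite uS; apply: le_trans (le_normcD _ _) _.
rewrite ComplexField.Normc.normcM.
apply: le_trans (lerD (ler_wpM2l (normc_ge0 z) IHl) (wK l)) _.
set a := normc z in gap0 *; set C := B + _.
(* the term K / (r - |z|) of C is chosen so that its slack absorbs K *)
have KE : K = K / (r - a) * (r - a) by rewrite divfK// gt_eqF.
rewrite exprS -subr_ge0.
have -> : C * (r * r ^+ l) - (a * (C * r ^+ l) + K * r ^+ l)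
          = B * (r - a) * r ^+ l by rewrite [in K * _]KE /C; ring.
by rewrite !mulr_ge0// ?exprn_ge0// ltW.
Qed.

Lemma entries_bound (R : rcfType) m n (X : 'M[R[i]]_(m, n)) :
  exists B, forall i j, normc (X i j) <= B.
Proof.
exists (\big[Num.max/0]_ij normc (X ij.1 ij.2)) => i j.
exact: (@le_bigmax _ _ _ 0 (fun ij => normc (X ij.1 ij.2)) (i, j)).
Qed.

(** Induction on the factors of the annihilator. With X' := X (G - z) one has
    X G^(l+1) = z X G^l + X' G^l, and X' is annihilated by one factor less, so
    each entry of X G^l solves a recurrence whose driving term is bounded by
    the induction hypothesis. Generalizing from 1 to X is what makes the
    induction go through. *)
Lemma annihilated_powers_bound (R : rcfType) d (G X : 'M[R[i]]_d)
    (s : seq R[i]) (r : R) :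
  {in s, forall z, normc z < r} ->
  X * \prod_(z <- s) (G - z%:M) = 0 -> 0 <= r ->
  exists K, forall l i j, normc ((X * G ^+ l) i j) <= K * r ^+ l.
Proof.
move=> sr + r0; elim: s X sr => [|z s IHs] X sr.
  rewrite big_nil mulr1 => ->; exists 0 => l i j.
  by rewrite mul0r mxE ComplexField.Normc.normc0 mul0r.
rewrite big_cons mulrA => /IHs[y ys|K HK]; first by rewrite sr// inE ys orbT.
have [B HB] := entries_bound X.
exists (B + K / (r - normc z)) => l i j.
move: l; apply: (@perturbed_geometric_bound _ _ (fun l => (X * G ^+ l) i j)
  (fun l => (X * (G - z%:M) * G ^+ l) i j)).
- by rewrite sr// mem_head.
- by rewrite expr0 mulr1.
- by move=> l; apply: HK.
- move=> l /=; rewrite mulrBr mulrBl -mulrA -exprS -[X * z%:M]/(X *m z%:M).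
  rewrite mul_mx_scalar -[(z *: X) * _]/((z *: X) *m _) -scalemxAl.
  by rewrite !mxE addrCA subrr addr0.
Qed.

Lemma char_poly_eigenvalues (F : closedFieldType) d (G : 'M[F]_d) :
  exists2 s, char_poly G = \prod_(z <- s) ('X - z%:P) &
    forall z, eigenvalue G z = (z \in s).
Proof.
have [s] := closed_field_poly_normal (char_poly G).
rewrite (monicP (char_poly_monic _)) scale1r => sE; exists s => // z.
by rewrite eigenvalue_root_char sE root_prod_XsubC.
Qed.

Lemma eigenvalues_norm_le (R : realType) d (G : 'M[R]_d) (z : R[i]) :
  eigenvalue (map_mx (real_complex R) G) z ->
  normc z <= spectral_radius G.
Proof.
move=> zG; apply: ub_le_sup; last by exists z.
(* the set of moduli is bounded, as it is finite: the supremum is not a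
   default value *)
have [s _ sG] := char_poly_eigenvalues (map_mx (real_complex R) G).
exists (\sum_(y <- s) normc y) => _ [y [+ ->]].
rewrite sG => ys.
rewrite (big_rem y)//= lerDl sumr_ge0// => *; exact: normc_ge0.
Qed.

(** Cayley-Hamilton makes the product of the G - z over the complex eigenvalues
    z an annihilator of the identity matrix, and every such z has modulus at
    most the spectral radius. *)
Lemma powers_bound (R : realType) d (G : 'M[R]_d) :
  spectral_radius G < 1 ->
  exists r K, [/\ 0 <= r, r < 1 &
    forall l i j, `|(G ^+ l) i j| <= K * r ^+ l].
Proof.
case: d G => [|d] G G1; first by exists 0, 0; split=> // l [].
pose Gc := map_mx (real_complex R) G.
(* any r between the spectral radius and 1 serves; the maximum spares a proof
   that the radius is nonnegative *)
pose r := (Num.max 0 (spectral_radius G) + 1) / 2.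
have m0 : 0 <= Num.max 0 (spectral_radius G) by rewrite le_max lexx.
have m1 : Num.max 0 (spectral_radius G) < 1 by rewrite gt_max ltr01.
have r0 : 0 <= r by rewrite /r; lra.
have r1 : r < 1 by rewrite /r; lra.
have rG : spectral_radius G < r.
  have : spectral_radius G <= Num.max 0 (spectral_radius G).
    by rewrite le_max lexx orbT.
  by rewrite /r; lra.
have [s sE sG] := char_poly_eigenvalues Gc.
have sr : {in s, forall z, normc z < r}.
  move=> z zs; apply: le_lt_trans rG; apply: eigenvalues_norm_le.
  by rewrite sG.
have ann : 1 * \prod_(z <- s) (Gc - z%:M) = 0.
  rewrite mul1r -(Cayley_Hamilton Gc) sE rmorph_prod.
  by apply: eq_bigr => z _; rewrite rmorphB /= horner_mx_X horner_mx_C.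
have [K HK] := annihilated_powers_bound sr ann r0.
exists r, K; split=> // l i j.
by rewrite -normc_real; have := HK l i j; rewrite mul1r -rmorphXn /= mxE.
Qed.

(** A singular 1 - G would have the eigenvalue 1. *)
Lemma one_sub_unitmx (R : realType) d (G : 'M[R]_d) :
  spectral_radius G < 1 -> 1%:M - G \in unitmx.
Proof.
move=> G1; rewrite -(map_unitmx (real_complex R)) unitmxE unitfE.
apply/negP => /det0P[v v0].
rewrite map_mxB map_mx1 mulmxBr mulmx1 => /eqP; rewrite subr_eq0 => /eqP vG.
have : eigenvalue (map_mx (real_complex R) G) 1.
  by apply/eigenvalueP; exists v => //; rewrite scale1r.
move=> /eigenvalues_norm_le; rewrite ComplexField.Normc.normc1.
by rewrite leNgt G1.
Qed.

(** * The covariance series and its fixed-point equation *)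

(** Only finitely many entries have to be close at the same time. *)
Lemma cvg_mx_entries (R : realType) (T : Type) (F : set_system T)
    {FF : Filter F} m n (f : T -> 'M[R]_(m, n)) (L : 'M[R]_(m, n)) :
  (forall i j, f x i j @[x --> F] --> L i j) -> f @ F --> L.
Proof.
move=> fL; apply/cvg_ballP => e e0.
have : \forall x \near F, forall ij : 'I_m * 'I_n,
    ball (L ij.1 ij.2) e (f x ij.1 ij.2).
  by apply: filter_forall => ij; by move/cvg_ballP: (fL ij.1 ij.2); apply.
by apply: filterS => x fx; split=> // i j; exact: (fx (i, j)).
Qed.

Lemma cvg_mx_entry (R : realType) (T : Type) (F : set_system T)
    {FF : Filter F} m n (f : T -> 'M[R]_(m, n)) (L : 'M[R]_(m, n)) i j :
  f @ F --> L -> f x i j @[x --> F] --> L i j.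
Proof. exact: (continuous_cvg FF (@coord_continuous R m n i j L)). Qed.

Lemma cvg_mulmx (R : realType) (T : Type) (F : set_system T)
    {FF : Filter F} m n p (f : T -> 'M[R]_(m, n)) (g : T -> 'M[R]_(n, p))
    (L : 'M[R]_(m, n)) (M : 'M[R]_(n, p)) :
  f @ F --> L -> g @ F --> M -> f x *m g x @[x --> F] --> L *m M.
Proof.
move=> fL gM; apply: cvg_mx_entries => i j; rewrite mxE.
under eq_fun do rewrite mxE.
apply: cvg_big => [|k _]; first exact: add_continuous.
by apply: cvgM; exact: cvg_mx_entry.
Qed.

Lemma trmx_exp (R : comNzRingType) d (G : 'M[R]_d) l : (G ^+ l)^T = G^T ^+ l.
Proof.
elim: l => [|l IHl]; first by rewrite !expr0 trmx1.
by rewrite exprS exprSr -IHl; exact: trmx_mul.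
Qed.

(** The terms of the covariance of sum_l G^l nu_l for independent noise nu_l of
    covariance Sigma. The sum S of the series solves the Stein (discrete
    Lyapunov) equation S = Sigma + G S G^T. *)
Definition stein_term (R : realType) d (G Sigma : 'M[R]_d) (l : nat) :=
  G ^+ l *m Sigma *m (G^T) ^+ l.

(** Each entry is dominated by a geometric series of ratio r^2, where r bounds
    the growth of the powers of G: two powers of G occur in each term. *)
Lemma stein_series_cvg (R : realType) d (G Sigma : 'M[R]_d) :
  spectral_radius G < 1 -> cvgn (series (stein_term G Sigma)).
Proof.
move=> /powers_bound[r [K [r0 r1 HK]]].
pose L : 'M[R]_d :=
  \matrix_(i, j) limn (fun n => series (stein_term G Sigma) n i j).
apply/cvg_ex; exists L.
apply: (@cvg_mx_entries R nat \oo _) => i j; rewrite mxE.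
have -> : (fun n => series (stein_term G Sigma) n i j)
          = series (fun l => stein_term G Sigma l i j).
  by apply/funext => n; rewrite /series /= summxE.
pose C := K ^+ 2 * \sum_k \sum_m `|Sigma m k|.
have rr1 : r ^+ 2 < 1 by rewrite expr_lt1.
have rr0 : 0 <= r ^+ 2 by rewrite sqr_ge0.
have K0 l : 0 <= K * r ^+ l by exact: le_trans (normr_ge0 _) (HK l i j).
apply: (@normed_cvg R R^o).
apply: (@series_le_cvg R _ (geometric C (r ^+ 2))) => [n|n|n|].
- exact: normr_ge0.
- rewrite /= mulr_ge0 ?exprn_ge0// mulr_ge0 ?sqr_ge0//.
  by rewrite sumr_ge0// => k _; rewrite sumr_ge0.
- rewrite /= /stein_term mxE; apply: le_trans (ler_norm_sum _ _ _) _.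
  rewrite /C mulrAC mulr_sumr; apply: ler_sum => k _.
  rewrite mxE mulr_suml; apply: le_trans (ler_norm_sum _ _ _) _.
  rewrite mulr_sumr; apply: ler_sum => m _.
  rewrite -trmx_exp [_^T _ _]mxE !normrM.
  have -> : K ^+ 2 * (r ^+ 2) ^+ n * `|Sigma m k|
            = K * r ^+ n * `|Sigma m k| * (K * r ^+ n).
    by rewrite -exprM mulnC exprM; ring.
  by rewrite ler_pM// ?mulr_ge0// ler_wpM2r.
- by apply: is_cvg_geometric_series; rewrite ger0_norm.
Qed.

Lemma stein_series_step (R : realType) d (G Sigma : 'M[R]_d) n :
  series (stein_term G Sigma) n.+1
  = Sigma + G *m series (stein_term G Sigma) n *m G^T.
Proof.
rewrite /series /= big_nat_recl// {1}/stein_term !expr0 mul1mx mulmx1.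
congr (_ + _); rewrite mulmx_sumr mulmx_suml; apply: eq_bigr => l _.
by rewrite /stein_term exprS exprSr !mulmxA.
Qed.

(** Conjugating a partial sum by G and adding Sigma gives the next partial sum;
    both sides pass to the limit. *)
Lemma stein_equation (R : realType) d (G Sigma : 'M[R]_d) :
  spectral_radius G < 1 ->
  let S := limn (series (stein_term G Sigma)) in S = Sigma + G *m S *m G^T.
Proof.
move=> G1 S; have SS := @stein_series_cvg _ _ _ Sigma G1.
have S1 : series (stein_term G Sigma) n.+1 @[n --> \oo] --> S.
  by rewrite (cvg_shiftS (series (stein_term G Sigma))).
apply: (cvg_unique _ S1) => //.
rewrite (_ : (fun n => _) = (fun n =>
    Sigma + G *m series (stein_term G Sigma) n *m G^T)); last first.
  by apply/funext => n; exact: stein_series_step.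
apply: cvgD; first exact: cvg_cst.
apply: cvg_mulmx; last exact: cvg_cst.
by apply: cvg_mulmx => //; exact: cvg_cst.
Qed.

Lemma stein_series_sym (R : realType) d (G Sigma : 'M[R]_d) n :
  Sigma^T = Sigma ->
  (series (stein_term G Sigma) n)^T = series (stein_term G Sigma) n.
Proof.
move=> Sym; rewrite /series /= linear_sum; apply: eq_bigr => l _ /=.
by rewrite /stein_term !trmx_mul -!trmx_exp trmxK Sym mulmxA.
Qed.

Lemma stein_sum_sym (R : realType) d (G Sigma : 'M[R]_d) :
  spectral_radius G < 1 -> Sigma^T = Sigma ->
  let S := limn (series (stein_term G Sigma)) in S^T = S.
Proof.
move=> G1 Sym S; have SS := @stein_series_cvg _ _ _ Sigma G1.
apply/matrixP => i j; rewrite mxE.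
have Sij a b : series (stein_term G Sigma) n a b @[n --> \oo] --> S a b.
  exact: cvg_mx_entry.
apply: (cvg_unique _ (Sij j i)) => //.
have -> : (fun n => series (stein_term G Sigma) n j i)
          = (fun n => series (stein_term G Sigma) n i j).
  by apply/funext => n; rewrite -[in RHS]stein_series_sym// mxE.
exact: Sij.
Qed.

Lemma quadratic_form_adjoint (R : comNzRingType) d (G C : 'M[R]_d)
    (u : 'cV[R]_d) :
  u^T *m (G *m C *m G^T) *m u = (G^T *m u)^T *m C *m (G^T *m u).
Proof. by rewrite trmx_mul trmxK !mulmxA. Qed.

Lemma stein_series_psd (R : realType) d (G Sigma : 'M[R]_d) n :
  posdefmx Sigma -> possemidefmx (series (stein_term G Sigma) n).
Proof.
move=> Pos u; rewrite /series /= mulmx_sumr mulmx_suml summxE.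
apply: sumr_ge0 => l _; rewrite /stein_term -trmx_exp quadratic_form_adjoint.
have [->|u0] := eqVneq ((G ^+ l)^T *m u) 0; first by rewrite mulmx0 mxE.
by rewrite ltW// Pos.
Qed.

(** The limit is positive semidefinite as a limit of semidefinite partial sums;
    the Stein equation then exhibits it as Sigma plus a semidefinite matrix,
    which gives strict positivity back. *)
Lemma stein_sum_posdef (R : realType) d (G Sigma : 'M[R]_d) :
  spectral_radius G < 1 -> posdefmx Sigma ->
  posdefmx (limn (series (stein_term G Sigma))).
Proof.
move=> G1 Pos u u0; have SS := @stein_series_cvg _ _ _ Sigma G1.
set S := limn _.
have Sv (v : 'cV[R]_d) : 0 <= (v^T *m S *m v) 0 0.
  have cv : (v^T *m series (stein_term G Sigma) n *m v) 0 0 @[n --> \oo]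
            --> (v^T *m S *m v) 0 0.
    apply: cvg_mx_entry; apply: cvg_mulmx; last exact: cvg_cst.
    by apply: cvg_mulmx => //; exact: cvg_cst.
  rewrite -(cvg_lim _ cv)//; apply: limr_ge.
    by apply/cvg_ex; eexists; exact: cv.
  by apply: nearW => n; exact: stein_series_psd.
rewrite [S]stein_equation// -/S mulmxDr mulmxDl mxE quadratic_form_adjoint.
by rewrite ltr_pwDl// Pos.
Qed.

Lemma posdefmx_unit (R : realType) d (C : 'M[R]_d) :
  posdefmx C -> C \in unitmx.
Proof.
move=> Pos; rewrite -unitmx_tr unitmxE unitfE; apply/negP => /det0P[v v0 vC].
have vT0 : v^T != 0 by apply: contraNneq v0 => v0; rewrite -[v]trmxK v0 trmx0.
have Cv : C *m v^T = 0 by rewrite -[C]trmxK -trmx_mul vC trmx0.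
by have := Pos _ vT0; rewrite -mulmxA Cv mulmx0 mxE ltxx.
Qed.

(** The quadratic form of the inverse at u is that of C at C^-1 u. *)
Lemma posdefmx_inv (R : realType) d (C : 'M[R]_d) :
  C^T = C -> posdefmx C -> posdefmx (invmx C).
Proof.
move=> Sym Pos u u0; have CU := posdefmx_unit Pos.
have -> : u^T *m invmx C *m u = (invmx C *m u)^T *m C *m (invmx C *m u).
  by rewrite trmx_mul trmx_inv Sym !mulmxA mulmxKV.
apply: Pos; apply: contraNneq u0 => Cu0.
by rewrite -(mulKVmx CU u) Cu0 mulmx0.
Qed.

(** * Linear images of Gaussian noise *)

(** The sets with Borel preimage form a sigma-algebra, and it contains the open
    sets since X |-> L X is continuous. *)
Lemma borel_preimage_mulmx (R : realType) d (L : 'M[R]_d) (B : set 'cV[R]_d) :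
  borel B -> borel [set x | B (L *m x)].
Proof.
move=> bB; pose G := [set B : set 'cV[R]_d | borel [set x | B (L *m x)]].
suff : @borel R d `<=` G by apply.
have [b0 bC bU] := smallest_sigma_algebra setT (@open 'cV[R]_d).
apply: smallest_sub; first by split=> [|A /bC|F /bU].
move=> U oU; apply: sub_sigma_algebra.
apply: (@open_comp _ _ (fun x : 'cV[R]_d => L *m x)) oU => x _.
by apply: (@cvg_mulmx R _ (nbhs x) _ _ _ _ (fun=> L)) => //; exact: cvg_cst.
Qed.

Lemma independent_vectors_comp (R : realType) d (disp : measure_display)
    (T : measurableType disp) (P : probability T R)
    (X : nat -> T -> 'cV[R]_d) (f : nat -> 'cV[R]_d -> 'cV[R]_d) :
  (forall k B, borel B -> borel (f k @^-1` B)) ->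
  independent_vectors P X -> independent_vectors P (fun k w => f k (X k w)).
Proof.
move=> bf [mX iX]; split=> [k B bB|s B us bB].
  exact: (mX k _ (bf k _ bB)).
exact: (iX s (fun k => f k @^-1` B k) us (fun k => bf k _ (bB k))).
Qed.

(** Testing L X against u is testing X against L^T u. *)
Lemma normal_vector_mulmx (R : realType) d (disp : measure_display)
    (T : measurableType disp) (P : probability T R) (X : T -> 'cV[R]_d)
    (m : 'cV[R]_d) (C L : 'M[R]_d) :
  normal_vector P X m C ->
  normal_vector P (fun w => L *m X w) (L *m m) (L *m C *m L^T).
Proof.
move=> [mX Csym Cpos lawX]; split.
- by move=> B bB; exact: (mX _ (borel_preimage_mulmx L bB)).
- by rewrite !trmx_mul trmxK Csym mulmxA.
- by move=> u; rewrite quadratic_form_adjoint.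
- move=> u B mB; rewrite quadratic_form_adjoint.
  have adj x : u^T *m (L *m x) = (L^T *m u)^T *m x.
    by rewrite trmx_mul trmxK mulmxA.
  by rewrite adj -lawX//; congr (P _); apply/funext => w /=; rewrite adj.
Qed.

(** The independent family starts with the initial state, which is not
    transformed: only the noise entries are multiplied by L. *)
Lemma normal_noise_mulmx (R : realType) d (disp : measure_display)
    (T : measurableType disp) (P : probability T R) (C L : 'M[R]_d)
    (Y nu : nat -> T -> 'cV[R]_d) :
  normal_noise P C Y nu ->
  normal_noise P (L *m C *m L^T) Y (fun k w => L *m nu k w).
Proof.
move=> [nuC ind]; split=> [k|].
  by rewrite -(mulmx0 _ L); exact: normal_vector_mulmx.
pose f (k : nat) : 'cV[R]_d -> 'cV[R]_d :=
  if k is _.+1 then mulmx L else @id 'cV[R]_d.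
have bf k B : borel B -> borel (f k @^-1` B).
  by case: k => [|k] //; exact: borel_preimage_mulmx.
rewrite (_ : (fun k : nat => _) = (fun k w =>
    f k ((if k is j.+1 then nu j else Y 0%N) w))).
  exact: (independent_vectors_comp bf ind).
by apply/funext => -[|k].
Qed.

(** Multiplying the recurrence by M, and back by its inverse, carries the noise
    nu to M nu, of covariance M Sigma M^T. *)
Lemma ar1_splitting (R : realType) d (M G Sigma : 'M[R]_d) (g : 'cV[R]_d)
    (disp : measure_display) (T : measurableType disp) (P : probability T R)
    (Y : nat -> T -> 'cV[R]_d) :
  M \in unitmx ->
  ar1_process P G g Sigma Y <->
  splitting_process P M (M *m G) (M *m g) (M *m Sigma *m M^T) Y.
Proof.
move=> MU; split=> -[nu [nuN YE]].
  exists (fun k w => M *m nu k w); split; first exact: normal_noise_mulmx.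
  by move=> k w; rewrite YE !mulmxDr mulmxA.
exists (fun k w => invmx M *m nu k w); split.
  have <- : invmx M *m (M *m Sigma *m M^T) *m (invmx M)^T = Sigma.
    by rewrite trmx_inv !mulmxA mulVmx// mul1mx mulmxK// unitmx_tr.
  exact: normal_noise_mulmx.
move=> k w; rewrite -[LHS](mulKmx MU) YE !mulmxDr -mulmxA !mulKmx//.
Qed.

(** Since M^-1 M^T M^-T = M^-1 and M^-1 (M G) = G, the right-hand side is
    M^-1 + G M^-T = (S - G S) + (G S - G S G^T), which the Stein equation
    identifies with Sigma. *)
Lemma splitting_covariance (R : comUnitRingType) d (G S Sigma M : 'M[R]_d) :
  M \in unitmx -> invmx M = (1%:M - G) *m S -> S^T = S ->
  S = Sigma + G *m S *m G^T ->
  Sigma = invmx M *m (M^T + M *m G) *m (invmx M)^T.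
Proof.
move=> MU Minv Ssym Seq.
have -> : invmx M *m (M^T + M *m G) *m (invmx M)^T
          = invmx M + G *m (invmx M)^T.
  rewrite mulmxDr mulKmx// mulmxDl; congr (_ + _).
  by rewrite trmx_inv mulmxK// unitmx_tr.
rewrite Minv trmx_mul Ssym linearB /= trmx1 mulmxBl mulmxBr mulmx1 mul1mx.
by rewrite mulmxBr addrA subrK {1}Seq mulmxA addrK.
Qed.

Theorem theorem2p1 (R : realType) (d : nat) (G Sigma : 'M[R]_d) (g : 'cV[R]_d)
    (Sigma_sym : Sigma^T = Sigma) (Sigma_pos : posdefmx Sigma)
    (G_radius : spectral_radius G < 1) :
  let S : nat -> 'M[R]_d :=
    series (fun l : nat => G ^+ l *m Sigma *m (G^T) ^+ l) in
  let A : 'M[R]_d := invmx (limn S) in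
  let M : 'M[R]_d := A *m invmx (1%:M - G) in
  let N : 'M[R]_d := A *m invmx (1%:M - G) *m G in
  let beta : 'cV[R]_d := A *m invmx (1%:M - G) *m g in
  (* the sum and the inverses in the statement exist *)
  [/\ cvgn S, limn S \in unitmx, 1%:M - G \in unitmx & M \in unitmx] /\
  (forall (disp : measure_display) (T : measurableType disp)
          (P : probability T R) (Y : nat -> T -> 'cV[R]_d),
     ar1_process P G g Sigma Y <->
     splitting_process P M N beta (M^T + N) Y) /\
  [/\ G = invmx M *m N, g = invmx M *m beta &
      Sigma = invmx M *m (M^T + N) *m (invmx M)^T] /\
  [/\ A = M - N, A^T = A & posdefmx A].
Proof.
move=> S A M N beta.
have SS : cvgn S := @stein_series_cvg R d G Sigma G_radius.
have Ssym : (limn S)^T = limn S := stein_sum_sym G_radius Sigma_sym.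
have Spos : posdefmx (limn S) := stein_sum_posdef G_radius Sigma_pos.
have Seq : limn S = Sigma + G *m limn S *m G^T := stein_equation Sigma G_radius.
have SU : limn S \in unitmx := posdefmx_unit Spos.
have HU := one_sub_unitmx G_radius.
have MU : M \in unitmx by rewrite unitmx_mul !unitmx_inv SU.
have Minv : invmx M = (1%:M - G) *m limn S.
  apply: (can_inj (mulKmx MU)).
  by rewrite mulmxV// /M /A -mulmxA mulKmx// mulVmx.
have SigmaE := splitting_covariance MU Minv Ssym Seq.
split; first by [].
split.
  move=> disp T P Y.
  have -> : M^T + N = M *m Sigma *m M^T.
    rewrite [in RHS]SigmaE !mulmxA mulmxV// mul1mx -mulmxA -trmx_mul.
    by rewrite mulmxV// trmx1 mulmx1.
  exact: ar1_splitting.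
split; first by split=> //; rewrite mulKmx.
split.
- by rewrite /N -/M -{1}[M]mulmx1 -mulmxBr /M mulmxKV.
- by rewrite /A trmx_inv Ssym.
- exact: posdefmx_inv.
Qed.
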